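(* Let $(H,\circ)$ be a hypersemigroup. Then $H$ is left quasi-regular if and only if, for every fuzzy subset $f$ of $H$, we have $f\preceq 1\circ f\circ 1\circ f$.
   Context: Let $\mathcal{P}^*(H)$ denote the set of nonempty subsets of $H$. A hypergroupoid is a nonempty set $H$ with a hyperoperation $\circ: H\times H\to \mathcal{P}^*(H)$, $(a,b)\mapsto a\circ b$; it induces an operation $*$ on $\mathcal{P}^*(H)$ by $A*B=\bigcup_{(a,b)\in A\times B}(a\circ b)$. A hypersemigroup is a hypergroupoid $H$ such that $(x\circ y)*\{z\}=\{x\}*(y\circ z)$ for all $x,y,z\in H$. A hypersemigroup $H$ is called left quasi-regular if for every $a\in H$ there exist $x,y\in H$ such that $a\in (x\circ a)*(y\circ a)$. A fuzzy subset of $H$ is a mapping $f:H\to[0,1]$ into the real closed unit interval. For $a\in H$ put $A_a=\{(y,z)\in H\times H\mid a\in y\circ z\}$. For fuzzy subsets $f,g$ of $H$, the fuzzy subset $f\circ g$ of $H$ is defined by $(f\circ g)(a)=\sup_{(y,z)\in A_a}\min\{f(y),g(z)\}$ if $A_a\neq\emptyset$, and $(f\circ g)(a)=0$ if $A_a=\emptyset$. (The same symbol $\circ$ is used for the hyperoperation on $H$ and the product of fuzzy subsets.) When $H$ is a hypersemigroup this product of fuzzy subsets is associative, so iterated products are written without parentheses. The order on fuzzy subsets is $f\preceq g$ if and only if $f(x)\le g(x)$ for every $x\in H$. The symbol $1$ denotes the fuzzy subset of $H$ with $1(x)=1$ for every $x\in H$. *)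

(* Defs.v *)
From mathcomp Require Import all_boot all_order all_algebra.
From mathcomp Require Import interval_inference all_classical all_reals.
Set Implicit Arguments.
Unset Strict Implicit.
Unset Printing Implicit Defensive.
Import Order.TTheory GRing.Theory Num.Theory.
Local Open Scope classical_set_scope.
Local Open Scope ring_scope.

Record hypergroupoid := Hypergroupoid {
  hcarrier :> Type;
  hcarrier_neq0 : [set: hcarrier] !=set0;
  hop : hcarrier -> hcarrier -> set hcarrier;
  hop_neq0 : forall x y, hop x y !=set0
}.

(* The induced operation on subsets. It is defined on all subsets; by
   [hmul_neq0] it restricts to an operation on the nonempty ones. *)
Definition hmul (H : hypergroupoid) (A B : set H) : set H :=
  \bigcup_(p in A `*` B) hop p.1 p.2.

Lemma hmul_neq0 (H : hypergroupoid) (A B : set H) :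
  A !=set0 -> B !=set0 -> hmul A B !=set0.
Proof.
move=> [a Aa] [b Bb]; have [c abc] := hop_neq0 a b.
by exists c; exists (a, b).
Qed.

Definition hypersemigroup (H : hypergroupoid) : Prop :=
  forall x y z : H, hmul (hop x y) [set z] = hmul [set x] (hop y z).

Definition left_quasi_regular (H : hypergroupoid) : Prop :=
  forall a : H, exists x y : H, hmul (hop x a) (hop y a) a.

Definition fuzzy (R : realType) (H : hypergroupoid) : Type := H -> {i01 R}.

Definition factorizations (H : hypergroupoid) (a : H) : set (H * H) :=
  [set p | hop p.1 p.2 a].

Section FuzzyProduct.
Variables (R : realType) (H : hypergroupoid).
Implicit Types f g h : fuzzy R H.

Definition fmin f g (p : H * H) : R := Num.min (f p.1)%:num (g p.2)%:num.

Definition fprod_val f g (a : H) : R :=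
  if factorizations a == set0 then 0
  else sup [set fmin f g p | p in factorizations a].

Lemma fmin_ge0 f g p : 0 <= fmin f g p.
Proof. by rewrite /fmin le_min; apply/andP; split. Qed.

Lemma fmin_le1 f g p : fmin f g p <= 1.
Proof. by rewrite /fmin ge_min; apply/orP; left. Qed.

Lemma fmin_has_sup f g a : factorizations a !=set0 ->
  has_sup [set fmin f g p | p in factorizations a].
Proof.
move=> [p Ap]; split; first by exists (fmin f g p); exists p.
by exists 1 => _ [q _ <-]; exact: fmin_le1.
Qed.

Lemma fprod_val_ge0 f g a : 0 <= fprod_val f g a.
Proof.
rewrite /fprod_val; case: eqP => // /eqP/set0P A0.
have [p Ap] := A0; apply: (le_trans (fmin_ge0 f g p)).
by apply: (sup_upper_bound (fmin_has_sup f g A0)); exists p.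
Qed.

Lemma fprod_val_le1 f g a : fprod_val f g a <= 1.
Proof.
rewrite /fprod_val; case: eqP => // /eqP/set0P A0.
apply: ge_sup; first by case: (fmin_has_sup f g A0).
by move=> _ [p _ <-]; exact: fmin_le1.
Qed.

Definition fprod f g : fuzzy R H :=
  fun a => Itv01 (fprod_val_ge0 f g a) (fprod_val_le1 f g a).

Definition fle f g : Prop := forall x : H, (f x)%:num <= (g x)%:num.

Definition fone : fuzzy R H := fun=> 1%:i01.

Lemma fprod_gt f g a (c : R) : 0 <= c -> c < (fprod f g a)%:num <->
  exists y z, [/\ hop y z a, c < (f y)%:num & c < (g z)%:num].
Proof.
move=> c0; rewrite /= /fprod_val; case: eqP => [A0|/eqP/set0P A0]; split.
- by rewrite ltNge c0.
- move=> [y [z [ayz _ _]]].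
  have : factorizations a (y, z) by [].
  by rewrite A0.
- move=> /(sup_gt (proj1 (fmin_has_sup f g A0))) [_ [[y z] ayz <-]].
  by rewrite /fmin lt_min => /andP[cy cz]; exists y, z.
- move=> [y [z [ayz cy cz]]]; apply: (@lt_le_trans _ _ (fmin f g (y, z))).
    by rewrite /fmin lt_min cy.
  by apply: (sup_upper_bound (fmin_has_sup f g A0)); exists (y, z).
Qed.

Lemma fprodA f g h : hypersemigroup H ->
  fprod f (fprod g h) = fprod (fprod f g) h.
Proof.
move=> HA; apply/funext => a; apply/val_inj.
have eq_lt (u v : fuzzy R H) :
    (forall c : R, 0 <= c -> c < (u a)%:num -> c < (v a)%:num) ->
    (u a)%:num <= (v a)%:num.
  move=> uv; rewrite leNgt; apply/negP => vu.
  have v0 : 0 <= (v a)%:num by [].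
  by have := uv _ v0 vu; rewrite ltxx.
apply/eqP; rewrite eq_le; apply/andP; split.
- apply: (eq_lt (fprod f (fprod g h)) (fprod (fprod f g) h)) => c c0.
  move=> /(fprod_gt _ _ _ c0) [x [w [axw cx /(fprod_gt _ _ _ c0)]]].
  move=> [y [z [wyz cy cz]]].
  have : hmul [set x] (hop y z) a by exists (x, w).
  rewrite -HA => -[[v z'] [/= vxy ->] avz].
  apply/(fprod_gt _ _ _ c0); exists v, z; split=> //.
  by apply/(fprod_gt _ _ _ c0); exists x, y.
- apply: (eq_lt (fprod (fprod f g) h) (fprod f (fprod g h))) => c c0.
  move=> /(fprod_gt _ _ _ c0) [v [z [avz /(fprod_gt _ _ _ c0)]]].
  move=> [x [y [vxy cx cy]]] cz.
  have : hmul (hop x y) [set z] a by exists (v, z).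
  rewrite HA => -[[x' w] [/= -> wyz] axw].
  apply/(fprod_gt _ _ _ c0); exists x, w; split=> //.
  by apply/(fprod_gt _ _ _ c0); exists y, z.
Qed.

End FuzzyProduct.

Arguments fone {R H}.

Declare Scope fuzzy_scope.
Delimit Scope fuzzy_scope with fuzzy.
(* Left associative; immaterial in a hypersemigroup, by [fprodA]. *)
Notation "f ∘ g" := (fprod f g) (at level 40, left associativity) : fuzzy_scope.
Notation "f ⪯ g" := (fle f g) (at level 70, no associativity) : fuzzy_scope.
Notation "1" := fone : fuzzy_scope.

(* Main.v *)
Require Import Defs.
From mathcomp Require Import all_boot all_order all_algebra.
From mathcomp Require Import interval_inference all_classical all_reals.

(** Everything happens at the level of strict cuts. For [0 <= c], the strict
[c]-cut of a product of fuzzy subsets is the [*]-product of the strict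
[c]-cuts of the factors ([fprod_gt]); thus [c < (1 ∘ f ∘ 1 ∘ f) a] says that
[a] lies in a product [H * F * H * F] with [F] the strict [c]-cut of [f]
([lt_fprod1_fprod1]). By associativity, left quasi-regularity says that
[a] lies in [H * {a} * H * {a}] for each [a]
([left_quasi_regular_chain]). If this holds and [c < f a], then [{a}] is
contained in [F], so [a] lies in [H * F * H * F]; since this is so for each
[c < f a], the inequality of fuzzy subsets follows. Conversely, the inequality
for the characteristic function of [{a}], read at the cut [c = 0], says that
[a] lies in [H * {a} * H * {a}]. *)

Set Implicit Arguments.
Unset Strict Implicit.
Unset Printing Implicit Defensive.
Import Order.TTheory GRing.Theory Num.Theory.
Local Open Scope classical_set_scope.
Local Open Scope ring_scope.

(** Moving the parentheses in [(x ∘ a) * (y ∘ a)] to the left gives the shape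
[((x ∘ a) * {y}) * {a}] of the iterated fuzzy product [1 ∘ f ∘ 1 ∘ f]. *)
Lemma left_quasi_regular_chain (H : hypergroupoid) : hypersemigroup H ->
  left_quasi_regular H <->
  forall a : H, exists x y u v : H, [/\ hop x a u, hop u y v & hop v a a].
Proof.
move=> hH; split=> lqr a.
- have [x [y [[u w] [/= xau yaw] uwa]]] := lqr a.
  have : hmul [set u] (hop y a) a by exists (u, w).
  rewrite -hH => -[[v _] [/= uyv ->] vaa].
  by exists x, y, u, v.
- have [x [y [u [v [xau uyv vaa]]]]] := lqr a.
  have : hmul (hop u y) [set a] a by exists (v, a).
  rewrite hH => -[[_ w] [/= -> yaw] uwa].
  by exists x, y, (u, w).
Qed.

Section FuzzyCuts.
Variables (R : realType) (H : hypergroupoid).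
Implicit Types (f g : fuzzy R H) (a : H) (c : R).

(** Negative cuts have to be left out: they are all of [H] for every fuzzy
subset, so [fprod_gt] fails for them at an element with no factorization.
Nothing is lost, since a failure of the inequality at [a] already shows at the
cut [c = g a], which is nonnegative. *)
Lemma fle_cut f g :
  (forall a c, 0 <= c -> c < (f a)%:num -> c < (g a)%:num) -> fle f g.
Proof.
move=> cut a; rewrite leNgt; apply/negP => ltgf.
have ga0 : 0 <= (g a)%:num by [].
by have := cut a _ ga0 ltgf; rewrite ltxx.
Qed.

(** The factors [1] constrain [x] and [y] only through [c < 1], so the witnesses
at their places are arbitrary. *)
Lemma lt_fprod1_fprod1 f g a c : 0 <= c ->
  c < ((1 ∘ f ∘ 1 ∘ g)%fuzzy a)%:num <->
  c < 1 /\ exists x b y d u v : H,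
    [/\ hop x b u, hop u y v, hop v d a, c < (f b)%:num & c < (g d)%:num].
Proof.
move=> c0; split.
- move=> /(fprod_gt _ _ _ c0)[v [d [vda]]].
  move=> /(fprod_gt _ _ _ c0)[u [y [uyv]]].
  move=> /(fprod_gt _ _ _ c0)[x [b [xbu c1 cb]]] _ cd.
  by split=> //; exists x, b, y, d, u, v.
- move=> [c1 [x [b [y [d [u [v [xbu uyv vda cb cd]]]]]]]].
  apply/(fprod_gt _ _ _ c0); exists v, d; split=> //.
  apply/(fprod_gt _ _ _ c0); exists u, y; split=> //.
  by apply/(fprod_gt _ _ _ c0); exists x, b.
Qed.

Definition fuzzy_point a : fuzzy R H :=
  fun x => if `[< x = a >] then 1%:i01 else 0%:i01.

Lemma fuzzy_point_gt0 a x : 0 < (fuzzy_point a x)%:num <-> x = a.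
Proof.
by rewrite /fuzzy_point; case: asboolP => xa; split=> //=; rewrite ?ltxx ?ltr01.
Qed.

End FuzzyCuts.

Theorem theorem9 (R : realType) (H : hypergroupoid) (hH : hypersemigroup H) :
  left_quasi_regular H <->
  (forall f : fuzzy R H, (f ⪯ 1 ∘ f ∘ 1 ∘ f)%fuzzy).
Proof.
split=> [/(left_quasi_regular_chain hH) lqr f|le1f1f].
- apply: fle_cut => a c c0 cfa.
  have [x [y [u [v [xau uyv vaa]]]]] := lqr a.
  apply/lt_fprod1_fprod1 => //; split; first exact: lt_le_trans cfa _.
  by exists x, a, y, a, u, v.
- apply/(left_quasi_regular_chain hH) => a.
  have a0 : 0 < (fuzzy_point R a a)%:num by apply/fuzzy_point_gt0.
  have /(lt_fprod1_fprod1 _ _ _ (lexx _)) := lt_le_trans a0 (le1f1f _ a).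
  move=> [_ [x [b [y [d [u [v [xbu uyv vda]]]]]]]].
  move=> /fuzzy_point_gt0 ba /fuzzy_point_gt0 da.
  by rewrite ba in xbu; rewrite da in vda; exists x, y, u, v.
Qed.
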